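(* Let $\mathscr{A}$ be any set of proper multiplications on $\mathbb{Z}^d$. There exists $A\subseteq\mathbb{Z}^d_{\neq0}$ such that: (I) for every $\circledast\in\mathscr{A}$, $A$ is thick in the semigroup $(\mathbb{Z}^d_{\neq0},\circledast)$; (II) for every proper multiplication $\odot$ on $\mathbb{Z}^d$ which is not aligned with any multiplication in $\mathscr{A}$, $A$ is not piecewise syndetic in $(\mathbb{Z}^d_{\neq0},\odot)$ and, if $(\mathbb{Z}^d_{\neq0},\odot)$ is left amenable, $d^*_\odot(A)=0$.
   Context: A proper multiplication on $\mathbb{Z}^d$ is a binary operation $\circledast:\mathbb{Z}^d\times\mathbb{Z}^d\to\mathbb{Z}^d$ making $(\mathbb{Z}^d,+)$ an associative (not necessarily commutative or unital) ring without zero divisors; $\mathbb{Z}^d_{\neq0}=\mathbb{Z}^d\setminus\{0\}$. Two proper multiplications $\circledast,\odot$ are aligned if there exist $v,w\in\mathbb{Z}^d_{\neq0}$ with $x\circledast v\circledast y=x\odot w\odot y$ for all $x,y\in\mathbb{Z}^d$. In a semigroup $(S,\cdot)$, with $s^{-1}\cdot A=\{t: s\cdot t\in A\}$: $A$ is thick if for every finite $F\subseteq S$ there is $x\in S$ with $F\cdot x\subseteq A$; piecewise syndetic if $s_1^{-1}\cdot A\cup\dots\cup s_k^{-1}\cdot A$ is thick for some $s_1,\dots,s_k\in S$. A semigroup is left amenable if the space of bounded complex functions on it admits a left-translation-invariant mean. $d^*_\odot(A)=\sup\{\alpha\ge0:\forall\text{ finite }F\subseteq\mathbb{Z}^d_{\neq0}\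 \exists s\in\mathbb{Z}^d_{\neq0},\ |(F\odot s)\cap A|\ge\alpha|F|\}$. *)

(* Defs.v *)
From mathcomp Require Import all_boot all_order all_algebra.
From mathcomp Require Import finmap.
From mathcomp Require Import all_classical all_reals.
From mathcomp Require Import complex.

Set Implicit Arguments.
Unset Strict Implicit.
Unset Printing Implicit Defensive.

Import Order.TTheory GRing.Theory Num.Theory.
Local Open Scope fset_scope.
Local Open Scope classical_set_scope.
Local Open Scope ring_scope.

Section Semigroup.
Variables (S : choiceType) (op : S -> S -> S).

Definition lquot (s : S) (A : set S) : set S := [set t | A (op s t)].

Definition thick (A : set S) : Prop :=
  forall F : {fset S}, exists x : S, forall f, f \in F -> A (op f x).

Definition piecewise_syndetic (A : set S) : Prop :=
  exists r : seq S, thick (\bigcup_(s in [set` r]) lquot s A).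

Variable R : realType.

Definition bounded_cfun (f : S -> R[i]) : Prop :=
  exists M : R[i], forall x, `|f x| <= M.

(* A mean is a positive normalized linear functional on the bounded functions;
   the values of [m] on unbounded functions are irrelevant.  In the order of
   [R[i]], [0 <= z] says that z is real and nonnegative. *)
Definition is_mean (m : (S -> R[i]) -> R[i]) : Prop :=
  [/\ forall (a : R[i]) (f g : S -> R[i]), bounded_cfun f -> bounded_cfun g ->
        m (fun x => a * f x + g x) = a * m f + m g,
      forall f : S -> R[i], bounded_cfun f -> (forall x, 0 <= f x) -> 0 <= m f
    & m (fun=> 1) = 1].

Definition left_invariant (m : (S -> R[i]) -> R[i]) : Prop :=
  forall (s : S) (f : S -> R[i]), bounded_cfun f ->
    m (fun t => f (op s t)) = m f.

Definition left_amenable : Prop :=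
  exists m : (S -> R[i]) -> R[i], is_mean m /\ left_invariant m.

Definition upper_density (A : set S) : R :=
  sup [set a : R | 0 <= a /\
    forall F : {fset S}, exists s : S,
      a * #|` F|%:R
        <= #|` [fset y in [fset op f s | f in F] | y \in A]|%:R].

End Semigroup.

Section ProperMultiplication.
Variable d : nat.

Record proper_mult := ProperMult {
  pmul :> 'rV[int]_d -> 'rV[int]_d -> 'rV[int]_d;
  pmulA : associative pmul;
  pmulDl : left_distributive pmul +%R;
  pmulDr : right_distributive pmul +%R;
  pmul_eq0 : forall x y, pmul x y = 0 -> x = 0 \/ y = 0
}.

Definition aligned (p q : proper_mult) : Prop :=
  exists v w : 'rV[int]_d, [/\ v != 0, w != 0 &
    forall x y, p (p x v) y = q (q x w) y].

Definition nzvec := {x : 'rV[int]_d | x != 0}.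

Lemma pmul_neq0 (p : proper_mult) (x y : nzvec) : p (val x) (val y) != 0.
Proof.
by apply/eqP => /pmul_eq0 [] h; [have := valP x | have := valP y];
  rewrite /= h eqxx.
Qed.

Definition nzmul (p : proper_mult) (x y : nzvec) : nzvec :=
  exist _ (p (val x) (val y)) (pmul_neq0 p x y).

Lemma nzmulA (p : proper_mult) : associative (nzmul p).
Proof. by move=> x y z; apply: val_inj; rewrite /= pmulA. Qed.

End ProperMultiplication.

(* Main.v *)
From HB Require Import structures.
Require Import Defs.
From mathcomp Require Import all_boot all_order all_algebra.
From mathcomp Require Import finmap.
From mathcomp Require Import all_classical all_reals.

Set Implicit Arguments.
Unset Strict Implicit.
Unset Printing Implicit Defensive.

Import Order.TTheory GRing.Theory Num.Theory.
Local Open Scope fset_scope.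
Local Open Scope classical_set_scope.
Local Open Scope ring_scope.

(** A proper multiplication extends to a division algebra structure on Q^d and
    is determined by its structure constants, so there are countably many of
    them.  Enumerate the pairs (F_n, *_n) of a finite set of nonzero vectors and
    a multiplication in the given family, and let A be the union of the blocks
    F_n *_n x_n; thickness is immediate.  The points x_n are chosen on a moment
    curve, avoiding finitely many points at each stage.

    Let o be a multiplication, and let g0 o s and g o s both lie in A, outside
    the first blocks.  A good choice of x_n forces them into the same block n,
    and forces the linear relation satisfied by x_n to hold identically: the
    left translation of (Q^d, o) by g g0^-1 is then a left translation of
    (Q^d, *_n).  For fixed g0 the vectors g with this property form a subspace;
    if it is all of Q^d then o is aligned with *_n.  Otherwise it contains fewer
    than d points of the moment curve.  So, if o is not aligned with any *_n,
    the translates of a long piece of the moment curve meet A, up to a fixed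
    finite set, in fewer than d points; the union of many dilates of this piece
    absorbs the finite set.  This gives both that A is not piecewise syndetic
    and that its density vanishes. *)

(** * Linear maps *)

Section LinearMaps.
Variables (R : pzRingType) (U W : lmodType R) (f : U -> W).
Hypothesis lf : linear f.

Lemma linear_map0 : f 0 = 0.
Proof. by have := lf (-1) 0 0; rewrite scaleN1r addNr scaleN1r addNr. Qed.

Lemma linear_mapB : {morph f : x y / x - y}.
Proof. by move=> x y; rewrite addrC -scaleN1r lf scaleN1r addrC. Qed.

Lemma linear_mapZ a : {morph f : x / a *: x}.
Proof. by move=> x; have := lf a x 0; rewrite linear_map0 !addr0. Qed.

End LinearMaps.

Lemma linear_inj_surj (K : fieldType) (d : nat) (f : 'rV[K]_d -> 'rV[K]_d) :
  linear f -> (forall x, f x = 0 -> x = 0) -> forall y, exists x, f x = y.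
Proof.
move=> lf f0 y.
pose g : {linear 'rV[K]_d -> 'rV[K]_d} :=
  HB.pack f (GRing.isLinear.Build _ _ _ _ f lf).
have gu : lin1_mx g \in unitmx.
  rewrite -row_free_unit -kermx_eq0; apply/rowV0P => v /sub_kermxP.
  by rewrite mul_rV_lin1; apply: f0.
exists (y *m invmx (lin1_mx g)).
by have := mul_rV_lin1 g (y *m invmx (lin1_mx g)); rewrite mulmxKV // => <-.
Qed.

(** * Division algebras on [K^d] and their left translations *)

Section DivisionAlgebra.
Variables (K : fieldType) (d : nat).
Local Notation V := 'rV[K]_d.

Record divalg := DivAlg {
  dmul : V -> V -> V;
  dunit : V;
  dinv : V -> V;
  dmulA : associative dmul;
  dmul_linl : forall y, linear (dmul^~ y);
  dmul_linr : forall x, linear (dmul x);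
  dmul1l : left_id dunit dmul;
  dmul1r : right_id dunit dmul;
  dmulVl : forall x, x != 0 -> dmul (dinv x) x = dunit;
  dmulVr : forall x, x != 0 -> dmul x (dinv x) = dunit
}.

(** Left multiplication by a nonzero vector is injective, hence surjective in finite dimension.
    Solving [a e = a] and cancelling [a] makes [e] a left unit, then a two-sided one; inverses arise
    the same way. *)
Lemma domain_divalg (m : V -> V -> V) : (0 < d)%N -> associative m ->
    (forall y, linear (m^~ y)) -> (forall x, linear (m x)) ->
    (forall x y, m x y = 0 -> x = 0 \/ y = 0) ->
  exists D : divalg, dmul D = m.
Proof.
move=> d_gt0 mA ml mr m0.
have mrI x y z : x != 0 -> m x y = m x z -> y = z.
  move=> x0 /eqP; rewrite -subr_eq0 -(linear_mapB (mr x)) => /eqP/m0[/eqP|/eqP].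
    by rewrite (negPf x0).
  by rewrite subr_eq0 => /eqP.
have mlI x y z : x != 0 -> m y x = m z x -> y = z.
  move=> x0 /eqP; rewrite -subr_eq0 -(linear_mapB (ml x)) => /eqP/m0[/eqP|/eqP].
    by rewrite subr_eq0 => /eqP.
  by rewrite (negPf x0).
have msurj x : x != 0 -> forall y, exists z, m x z = y.
  move=> x0; apply: linear_inj_surj (mr x) _ => z /m0[] // /eqP.
  by rewrite (negPf x0).
pose a : V := const_mx 1.
have a0 : a != 0.
  apply/eqP => /rowP/(_ (Ordinal d_gt0)); rewrite !mxE => /eqP.
  by rewrite oner_eq0.
have [e ae] := msurj a a0 a.
have e1 x : m e x = x by apply: (mrI a) => //; rewrite mA ae.
have e0 : e != 0.
  by apply: contra a0 => /eqP e0; rewrite -ae e0 (linear_map0 (mr a)).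
have e2 x : m x e = x by apply: (mlI e) => //; rewrite -mA e1.
have /choice[i iP] (x : V) : exists y, x != 0 -> m x y = e.
  by have [->|/msurj/(_ e)[y]] := eqVneq x 0; [exists 0 | exists y].
have iV x : x != 0 -> m (i x) x = e.
  move=> x0; apply: (mrI x) => //; by rewrite mA iP // e1 e2.
by exists (DivAlg mA ml mr e1 e2 iV iP).
Qed.

Lemma dunit_neq0 (D : divalg) (x : V) : x != 0 -> dunit D != 0.
Proof.
by apply: contra => /eqP e0; rewrite -(dmul1l D x) e0 (linear_map0 (dmul_linl D x)).
Qed.

Lemma dmul_neq0 (D : divalg) (x y : V) : x != 0 -> y != 0 -> dmul D x y != 0.
Proof.
move=> x0; apply: contra => /eqP xy0; apply/eqP.
by rewrite -(dmul1l D y) -(dmulVl D x0) -dmulA xy0 (linear_map0 (dmul_linr D _)).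
Qed.

(* The hypothesis says that every left translation of [D] is one of [D'].  The
   surjection [y |-> y * 1'] then commutes with the left translations of [D'],
   hence is a right translation of [D']. *)
Lemma left_translations_sandwich (D D' : divalg) :
    (forall y u, dmul D y u = dmul D' (dmul D y (dunit D')) u) ->
  forall x z, dmul D x z =
    dmul D' (dmul D' x (dmul D (dunit D') (dunit D'))) z.
Proof.
set e := dunit D' => H x z.
have [->|x0] := eqVneq x 0.
  by rewrite (linear_map0 (dmul_linl D _)) (linear_map0 (dmul_linl D' _))
    (linear_map0 (dmul_linl D' _)).
have e0 : e != 0 by apply: dunit_neq0 x0.
rewrite H; congr dmul.
pose a := dmul D x (dinv D e).
have ae : dmul D a e = x by rewrite -dmulA dmulVl // dmul1r.
have ax : dmul D a e = dmul D' x e by rewrite H ae.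
by rewrite -{1}(dmul1r D' x) -/e -ax -dmulA H ae.
Qed.

(* The left translation of [D] by [g g0^-1] is a left translation of [D']. *)
Definition transfer (D D' : divalg) (g0 g : V) : Prop :=
  let h := dmul D g (dinv D g0) in
  forall u, dmul D h u = dmul D' (dmul D h (dunit D')) u.

(** Substituting [z = f0^-1 u] shows that left translation by [h] in [D] is left translation by
    [f f0^-1] in [D']; evaluating at the unit of [D'] identifies that element as [h 1']. *)
Lemma transferP (D D' : divalg) (g0 g f0 f : V) : g0 != 0 -> f0 != 0 ->
    (forall z, dmul D (dmul D g (dinv D g0)) (dmul D' f0 z) = dmul D' f z) ->
  transfer D D' g0 g.
Proof.
move=> g00 f00 H; rewrite /transfer; set h := dmul D g _.
have hE u : dmul D h u = dmul D' (dmul D' f (dinv D' f0)) u.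
  by rewrite -dmulA -H dmulA dmulVr // dmul1l.
by move=> u; rewrite [in RHS]hE dmul1r hE.
Qed.

End DivisionAlgebra.

(** * Extension of scalars from the integers to the rationals *)

Section RationalExtension.
Variable d : nat.

Definition toQ (n : nat) (x : 'rV[int]_n) : 'rV[rat]_n := map_mx intr x.

Lemma toQ_eq0 n (x : 'rV[int]_n) : (toQ x == 0) = (x == 0).
Proof.
apply/eqP/eqP => [/rowP x0|->]; last by apply/rowP => i; rewrite !mxE.
apply/rowP => i; have /eqP := x0 i; rewrite !mxE intr_eq0.
by move/eqP.
Qed.

Lemma toQ_inj n : injective (@toQ n).
Proof.
move=> x y xy; apply/eqP; rewrite -subr_eq0 -toQ_eq0 /toQ map_mxB -/(toQ x).
by rewrite xy subrr.
Qed.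

Lemma clear_denominators n (x : 'rV[rat]_n) :
  exists (N : int) (z : 'rV[int]_n), N != 0 /\ N%:~R *: x = toQ z.
Proof.
exists (\prod_i denq (x 0 i)).
exists (\row_i ((\prod_(j < n | j != i) denq (x 0 j)) * numq (x 0 i))).
split; first by apply/prodf_neq0 => i _; apply: denq_neq0.
apply/rowP => i; rewrite !mxE (bigD1 i) //= mulrC rmorphM mulrA -numqE.
by rewrite mulrC -rmorphM.
Qed.

Lemma ex_scaled_int n (x : 'rV[rat]_n) : exists a z, x = a *: toQ z.
Proof.
have [N [z [N0 Nx]]] := clear_denominators x.
by exists (N%:~R^-1), z; rewrite -Nx scalerA mulVf ?scale1r // intr_eq0.
Qed.

Variable p : proper_mult d.

Lemma additive_linear_int (U W : lmodType int) (f : U -> W) :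
  {morph f : x y / x + y} -> linear f.
Proof.
move=> fD a x y; rewrite fD; congr (_ + _).
have f0 : f 0 = 0 by apply: (addrI (f 0)); rewrite -fD !addr0.
pose g : {additive U -> W} := HB.pack f
  (GRing.isNmodMorphism.Build U W f (conj f0 fD)).
by rewrite -[a]intz !scaler_int -[f]/(g : _ -> _) raddfMz.
Qed.

Lemma pmul_linear_l y : linear (p^~ y).
Proof. by apply: additive_linear_int => x x'; apply: pmulDl. Qed.

Lemma pmul_linear_r x : linear (p x).
Proof. by apply: additive_linear_int => y y'; apply: pmulDr. Qed.

Definition pext (x y : 'rV[rat]_d) : 'rV[rat]_d :=
  \sum_i \sum_j (x 0 i * y 0 j) *: toQ (p 'e_i 'e_j).

Lemma pext_linear_l y : linear (pext^~ y).
Proof.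
move=> a x x'; rewrite /pext scaler_sumr -big_split; apply: eq_bigr => i _ /=.
rewrite scaler_sumr -big_split; apply: eq_bigr => j _ /=.
by rewrite !mxE scalerA -scalerDl mulrDl mulrA.
Qed.

Lemma pext_linear_r x : linear (pext x).
Proof.
move=> a y y'; rewrite /pext scaler_sumr -big_split; apply: eq_bigr => i _ /=.
rewrite scaler_sumr -big_split; apply: eq_bigr => j _ /=.
by rewrite !mxE scalerA -scalerDl mulrDr mulrCA.
Qed.

Lemma pmul_sum x y :
  p x y = \sum_i \sum_j (x 0 i * y 0 j) *: p 'e_i 'e_j.
Proof.
pose fl z : {linear 'rV[int]_d -> 'rV[int]_d} := HB.pack (p^~ z)
  (GRing.isLinear.Build _ _ _ _ (p^~ z) (pmul_linear_l z)).
pose fr z : {linear 'rV[int]_d -> 'rV[int]_d} := HB.pack (p z)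
  (GRing.isLinear.Build _ _ _ _ (p z) (pmul_linear_r z)).
rewrite {1}[x]row_sum_delta -[p _ y]/(fl y _) linear_sum; apply: eq_bigr => i _.
rewrite linearZ /= {1}[y]row_sum_delta -[p _ _]/(fr _ _) linear_sum scaler_sumr.
by apply: eq_bigr => j _; rewrite linearZ /= scalerA.
Qed.

Lemma pext_toQ x y : pext (toQ x) (toQ y) = toQ (p x y).
Proof.
rewrite pmul_sum /toQ raddf_sum; apply: eq_bigr => i _.
rewrite raddf_sum; apply: eq_bigr => j _.
by rewrite !mxE -rmorphM -map_mxZ.
Qed.

Lemma pextZl a x y : pext (a *: x) y = a *: pext x y.
Proof. exact: (linear_mapZ (pext_linear_l y)). Qed.

Lemma pextZr a x y : pext x (a *: y) = a *: pext x y.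
Proof. exact: (linear_mapZ (pext_linear_r x)). Qed.

Lemma pextA : associative pext.
Proof.
move=> x y z.
have [a [x' ->]] := ex_scaled_int x.
have [b [y' ->]] := ex_scaled_int y; have [c [z' ->]] := ex_scaled_int z.
rewrite !(pextZl, pextZr, pext_toQ) pmulA !scalerA.
by rewrite -[c * a * b]mulrA [c * _]mulrC.
Qed.

Lemma pext_eq0 x y : pext x y = 0 -> x = 0 \/ y = 0.
Proof.
have [a [x' ->]] := ex_scaled_int x; have [b [y' ->]] := ex_scaled_int y.
rewrite pextZl pextZr pext_toQ => /eqP.
rewrite !scaler_eq0 toQ_eq0 => /or3P[/eqP->|/eqP->|/eqP/pmul_eq0].
- by left; rewrite scale0r.
- by right; rewrite scale0r.
- by case=> ->; [left | right]; rewrite /toQ map_mx0 scaler0.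
Qed.

End RationalExtension.

(** * Alignment read off from the rational algebras *)

Section RationalAlgebra.
Variable d : nat.
Local Notation vec := 'rV[int]_d.+1.

Lemma ex_divalg (p : proper_mult d.+1) :
  exists D : divalg rat d.+1,
    forall x y, dmul D (toQ x) (toQ y) = toQ (p x y).
Proof.
have [D DE] := domain_divalg (ltn0Sn d) (pextA p) (pext_linear_l p)
  (pext_linear_r p) (@pext_eq0 _ p).
by exists D => x y; rewrite DE pext_toQ.
Qed.

Definition qalg (p : proper_mult d.+1) : divalg rat d.+1 := projT1 (cid (ex_divalg p)).

Lemma qalgE p x y : dmul (qalg p) (toQ x) (toQ y) = toQ (p x y).
Proof. exact: (projT2 (cid (ex_divalg p))). Qed.

Lemma sandwich_aligned (q p : proper_mult d.+1) :
    (forall y u, dmul (qalg q) y u =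
       dmul (qalg p) (dmul (qalg q) y (dunit (qalg p))) u) ->
  aligned q p.
Proof.
move=> /left_translations_sandwich; set k := dmul _ _ _ => kE.
have a0 : (const_mx 1 : vec) != 0.
  by apply/eqP => /rowP/(_ ord0); rewrite !mxE.
set a : vec := const_mx 1 in a0.
have k0 : k != 0.
  by apply: dmul_neq0; apply: (@dunit_neq0 _ _ _ (toQ a)); rewrite toQ_eq0.
have [N [z [N0 Nk]]] := clear_denominators k.
have z0 : z != 0 by rewrite -toQ_eq0 -Nk scaler_eq0 intr_eq0 negb_or N0.
have nz x y : x != 0 -> y != 0 -> p x y != 0.
  by move=> x0 y0; apply/eqP => /pmul_eq0[] /eqP; apply/negP.
(* Clearing denominators in [k] turns each product of [q] into a [p]-product with [z] inserted, at
   the cost of a factor [N]. The product [x a y] in [q] contains two of them, whence [N^2] on one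
   side and [z a z] on the other. *)
exists ((N * N) *: a), (p (p z a) z); split.
- apply: contra N0 => /eqP/rowP/(_ ord0)/eqP.
  by rewrite !mxE mulr1 mulf_eq0 orbb.
- exact: nz (nz _ _ z0 a0) z0.
have NE x y : N *: q x y = p (p x z) y.
  apply: toQ_inj; rewrite -!qalgE -Nk (linear_mapZ (dmul_linr _ _)).
  rewrite (linear_mapZ (dmul_linl _ _)) -kE qalgE.
  by apply/rowP => i; rewrite !mxE rmorphM.
have pl u := linear_mapZ (@pmul_linear_l _ p u).
have ql u := linear_mapZ (@pmul_linear_l _ q u).
have qr u := linear_mapZ (@pmul_linear_r _ q u).
move=> x y; rewrite qr ql -scalerA NE -pl -pl NE.
by rewrite !pmulA.
Qed.

End RationalAlgebra.

(** * Properties of all but finitely many naturals *)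

Definition cofinitely (P : nat -> Prop) : Prop := finite_set [set t | ~ P t].

Lemma cofinitely_ex P : cofinitely P -> exists t, P t.
Proof.
move=> finP; apply: contrapT => /forallNP nP; apply: infinite_nat.
by apply: sub_finite_set finP => t _; apply: nP.
Qed.

Lemma sub_cofinitely (P Q : nat -> Prop) :
  (forall t, P t -> Q t) -> cofinitely P -> cofinitely Q.
Proof. by move=> PQ; apply: sub_finite_set => t /= nQ /PQ. Qed.

Lemma cofinitelyI (P Q : nat -> Prop) :
  cofinitely P -> cofinitely Q -> cofinitely (fun t => P t /\ Q t).
Proof.
move=> fP fQ; have : finite_set ([set t | ~ P t] `|` [set t | ~ Q t]).
  by rewrite finite_setU.
by apply: sub_finite_set => t /= /not_andP.
Qed.

Lemma cofinitely_forall (T : Type) (D : set T) (P : T -> nat -> Prop) :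
    finite_set D -> (forall a, cofinitely (P a)) ->
  cofinitely (fun t => forall a, D a -> P a t).
Proof.
move=> fD fP; have : finite_set (\bigcup_(a in D) [set t | ~ P a t]).
  by apply: bigcup_finite => // a _; apply: fP.
by apply: sub_finite_set => t /= /existsNP[a] /not_implyP[Da nP]; exists a.
Qed.

Lemma cofinitely_subsingleton P :
  (forall t t', ~ P t -> ~ P t' -> t = t') -> cofinitely P.
Proof.
move=> uP; have [[t0 nP]|nP] := pselect (exists t, ~ P t).
  by apply: sub_finite_set (finite_set1 t0) => t nPt; apply: uP.
by apply: sub_finite_set (finite_set0 _) => t nPt; apply: nP; exists t.
Qed.

Lemma finite_below (T : Type) (nu : T -> nat) (n : nat) :
  injective nu -> finite_set [set x | (nu x < n)%N].
Proof.
move=> nuI; apply: (finite_preimage (B := `I_n)); last exact: finite_II.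
by move=> x y _ _; apply: nuI.
Qed.

(** * The moment curve and linear conditions along it *)

Section Curve.
Variable d : nat.
Local Notation vec := 'rV[int]_d.+1.

(* The scalars [2 ^ t * 3 ^ j] make [(j, t) |-> curve j t] injective even in
   dimension one, where the moment curve is constant. *)
Definition curve (j t : nat) : vec := \row_i (2 ^ t * 3 ^ j * t ^ i)%:Z.

Lemma curve_neq0 j t : curve j t != 0.
Proof.
apply/eqP => /rowP/(_ ord0); rewrite !mxE expn0 muln1 => /eqP.
by rewrite eqz_nat muln_eq0 !expn_eq0.
Qed.

Definition nzcurve (j t : nat) : nzvec d.+1 := exist _ (curve j t) (curve_neq0 j t).

Lemma nzcurve_inj j t j' t' : nzcurve j t = nzcurve j' t' -> j = j' /\ t = t'.
Proof.
move/(congr1 val)/rowP/(_ ord0); rewrite !mxE !expn0 !muln1 => /eqP.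
rewrite eqz_nat => /eqP E; split.
  by have := congr1 (logn 3) E; rewrite !lognM ?expn_gt0 // !lognX !(logn_prime 3) //
     !muln0 !muln1.
by have := congr1 (logn 2) E; rewrite !lognM ?expn_gt0 // !lognX !(logn_prime 2) //
  !muln0 !muln1 !addn0.
Qed.

Lemma toQ_curve j t :
  toQ (curve j t) = (2 ^ t * 3 ^ j)%:R *: \row_i (t%:R ^+ i).
Proof. by apply/rowP => i; rewrite !mxE -pmulrn [LHS]natrM [(t ^ i)%:R]natrX. Qed.

(** Up to the nonzero scalar [2 ^ t], each coordinate of [f] along the curve is a polynomial in [t]
    of degree at most [d], whose coefficients form a column of the matrix of [f]. More than [d]
    roots make it vanish. *)
Lemma linear_curve0 (n : nat) (f : 'rV[rat]_d.+1 -> 'rV[rat]_n) (s : seq nat) :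
    linear f -> uniq s -> (d < size s)%N ->
    {in s, forall t, f (toQ (curve 0 t)) = 0} ->
  forall x, f x = 0.
Proof.
move=> lf us ds fs.
pose g : {linear 'rV[rat]_d.+1 -> 'rV[rat]_n} :=
  HB.pack f (GRing.isLinear.Build _ _ _ _ f lf).
suff g0 : lin1_mx g = 0.
  by move=> x; rewrite -[f x]/(g x) -mul_rV_lin1 g0 mulmx0.
apply/matrixP => i j; rewrite [RHS]mxE.
pose P : {poly rat} := \poly_(k < d.+1) (lin1_mx g (inord k) j).
suff P0 : P = 0.
  have := coef_poly d.+1 (fun k => lin1_mx g (inord k) j) i.
  by rewrite -/P P0 coef0 ltn_ord inord_val => <-.
apply/eqP; apply/negPn/negP => P0.
have us' : uniq [seq t%:R : rat | t <- s].
  by rewrite map_inj_uniq // => a b /eqP; rewrite eqr_nat => /eqP.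
have rP : all (root P) [seq t%:R : rat | t <- s].
  apply/allP => _ /mapP[t ts ->]; apply/rootP.
  have /rowP/(_ j) := fs t ts; rewrite toQ_curve (linear_mapZ lf) !mxE => /eqP.
  rewrite mulf_eq0 pnatr_eq0 muln_eq0 !expn_eq0 /= => /eqP.
  rewrite -[f _]/(g _) -mul_rV_lin1 mxE => E; rewrite horner_poly -[RHS]E.
  by apply: eq_bigr => k _; rewrite inord_val !mxE mulrC.
have := max_poly_roots P0 rP us'; rewrite size_map ltnNge => /negP; apply.
by apply: leq_trans ds; apply: size_poly.
Qed.

Lemma cofinitely_linear_curve (n : nat) (f : 'rV[rat]_d.+1 -> 'rV[rat]_n) :
  linear f -> cofinitely (fun t => f (toQ (curve 0 t)) = 0 -> forall x, f x = 0).
Proof.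
move=> lf; apply: contrapT => /(infinite_set_fset d.+1)[B BP dB].
have B0 : {in B, forall t, f (toQ (curve 0 t)) = 0}.
  by move=> t /BP /= /not_implyP[].
have f0 := linear_curve0 lf (fset_uniq B) dB B0.
have /fset0Pn[t /BP] : B != fset0 by rewrite -cardfs_gt0 (leq_ltn_trans _ dB).
by move=> /= /not_implyP[_]; apply.
Qed.

Lemma nzmulI (p : proper_mult d.+1) (a x y : nzvec d.+1) :
  nzmul p a x = nzmul p a y -> x = y.
Proof.
move=> /(congr1 val) /= pxy; apply: val_inj => /=; apply/eqP.
rewrite -subr_eq0; apply/eqP.
have /pmul_eq0[/eqP|//] : p (val a) (val x - val y) = 0.
  by rewrite (linear_mapB (pmul_linear_r p _)) pxy subrr.
by rewrite (negPf (valP a)).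
Qed.

Lemma nzmul_Ir (p : proper_mult d.+1) (a x y : nzvec d.+1) :
  nzmul p x a = nzmul p y a -> x = y.
Proof.
move=> /(congr1 val) /= pxy; apply: val_inj => /=; apply/eqP.
rewrite -subr_eq0; apply/eqP.
have /pmul_eq0[//|/eqP] : p (val x - val y) (val a) = 0.
  by rewrite (linear_mapB (pmul_linear_l p _)) pxy subrr.
by rewrite (negPf (valP a)).
Qed.

Definition nztransfer (q p : proper_mult d.+1) (g0 g : nzvec d.+1) : Prop :=
  transfer (qalg q) (qalg p) (toQ (val g0)) (toQ (val g)).

(** At most one [t] fails: by cancellation [y] determines [s], hence the point [g s], and distinct
    [t] give distinct points of the new block. *)
Lemma cofinitely_separated (q p : proper_mult d.+1) (g0 g f y : nzvec d.+1) :
  cofinitely (fun t => forall s, nzmul q g0 s = y ->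
    nzmul q g s <> nzmul p f (nzcurve 0 t)).
Proof.
apply: cofinitely_subsingleton => t t'.
move=> /existsNP[s /not_implyP[<- /contrapT E]].
move=> /existsNP[s' /not_implyP[/nzmulI -> /contrapT E']].
by have /nzmulI/nzcurve_inj[] := etrans (esym E) E'.
Qed.

(** Eliminating [s = g0^-1 f0 x] from the two equations leaves the linear condition [F x = 0] on the
    curve point [x]. For all but finitely many [t] this forces [F] to vanish identically, which is
    the hypothesis of [transferP]. *)
Lemma cofinitely_transfer (q p : proper_mult d.+1) (g0 g f0 f : nzvec d.+1) :
  cofinitely (fun t => forall s,
    nzmul q g0 s = nzmul p f0 (nzcurve 0 t) ->
    nzmul q g s = nzmul p f (nzcurve 0 t) -> nztransfer q p g0 g).
Proof.
pose Dq := qalg q; pose Dp := qalg p.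
pose h := dmul Dq (toQ (val g)) (dinv Dq (toQ (val g0))).
pose F z := dmul Dq h (dmul Dp (toQ (val f0)) z) - dmul Dp (toQ (val f)) z.
have g00 : toQ (val g0) != 0 by rewrite toQ_eq0 (valP g0).
have f00 : toQ (val f0) != 0 by rewrite toQ_eq0 (valP f0).
have lF : linear F.
  move=> a x y; rewrite /F !(dmul_linr _ _) scalerBr.
  by rewrite opprD addrACA.
apply: sub_cofinitely (cofinitely_linear_curve lF) => t Ft s E0 E.
apply: (transferP (f0 := toQ (val f0)) (f := toQ (val f))) => // z.
apply/eqP; rewrite -subr_eq0; apply/eqP; apply: Ft.
have E0' : dmul Dq (toQ (val g0)) (toQ (val s)) = dmul Dp (toQ (val f0)) (toQ (curve 0 t)).
  by rewrite !qalgE; congr toQ; apply: (congr1 val E0).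
have E' : dmul Dq (toQ (val g)) (toQ (val s)) = dmul Dp (toQ (val f)) (toQ (curve 0 t)).
  by rewrite !qalgE; congr toQ; apply: (congr1 val E).
rewrite /F -E0' -E' /h -dmulA [dmul _ (dinv _ _) (dmul _ _ _)]dmulA dmulVl //.
rewrite dmul1l.
by rewrite subrr.
Qed.

(* If [d.+1] points of the curve transfer then, by linearity, all vectors do. *)
Lemma transfer_curve_aligned (q p : proper_mult d.+1) (a : nzvec d.+1)
    (t0 : nat) (s : seq nat) :
    uniq s -> (d < size s)%N ->
    {in s, forall t, nztransfer q p (nzmul q a (nzcurve 0 t0)) (nzmul q a (nzcurve 0 t))} ->
  aligned q p.
Proof.
move=> us ds sP; apply: sandwich_aligned => y u.
pose Dq := qalg q; pose Dp := qalg p.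
pose g0 := toQ (val (nzmul q a (nzcurve 0 t0))).
have g00 : g0 != 0 by rewrite toQ_eq0 (valP (nzmul _ _ _)).
have a0 : toQ (val a) != 0 by rewrite toQ_eq0 (valP a).
pose G z := dmul Dq (dmul Dq (toQ (val a)) z) (dinv Dq g0).
pose F z := dmul Dq (G z) u - dmul Dp (dmul Dq (G z) (dunit Dp)) u.
have lG : linear G.
  by move=> b x x'; rewrite /G (dmul_linr _ _) (dmul_linl _ _).
have lF : linear F.
  move=> b x x'; rewrite /F lG !(dmul_linl _ _) scalerBr.
  by rewrite opprD addrACA.
have F0 : {in s, forall t, F (toQ (curve 0 t)) = 0}.
  move=> t /sP /(_ u); rewrite -qalgE -/Dq => E.
  by apply/eqP; rewrite subr_eq0; apply/eqP.
(* The argument is the preimage of [y] under [G]. *)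
have := linear_curve0 lF us ds F0 (dmul Dq (dinv Dq (toQ (val a))) (dmul Dq y g0)).
rewrite /F /G !dmulA dmulVr // dmul1l -(dmulA Dq y) dmulVr // dmul1r.
by move/eqP; rewrite subr_eq0 => /eqP.
Qed.

End Curve.

(** * Decoding and counting *)

Lemma ex_decoder (T : Type) (nu : T -> nat) : injective nu ->
  exists dec : nat -> option T, forall x, dec (nu x) = Some x.
Proof.
move=> nuI; have /choice[dec decP] n : exists o, forall x, nu x = n -> o = Some x.
  have [[x <-]|nx] := pselect (exists x, nu x = n).
    by exists (Some x) => y /nuI ->.
  by exists None => x xn; case: nx; exists x.
by exists dec => x; apply: decP.
Qed.

Lemma ex_strict_bound (s : seq nat) : exists N, {in s, forall x, (x < N)%N}.
Proof.
by exists (\max_(x <- s) x).+1 => x xs; rewrite ltnS; apply: leq_bigmax_seq.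
Qed.

Lemma count_has (T U : Type) (P : U -> T -> bool) (r : seq U) (L : seq T) :
  (count (fun x => has (P^~ x) r) L <= \sum_(a <- r) count (P a) L)%N.
Proof.
elim: r => [|a r IH]; first by rewrite big_nil /= count_pred0.
rewrite big_cons; apply: leq_trans (leq_add (leqnn _) IH).
have := count_predUI (P a) (fun x => has (P^~ x) r) L => <-.
exact: leq_addr.
Qed.

Lemma count_allpairs (S T U : Type) (f : S -> T -> U) (P : pred U) s t :
  count P [seq f x y | x <- s, y <- t] = \sum_(x <- s) count (P \o f x) t.
Proof.
elim: s => [|x s IH]; first by rewrite big_nil.
by rewrite /= count_cat IH big_cons count_map.
Qed.

(** * Enumeration of the stages and choice of base points *)

Section Construction.
Variable d : nat.
Local Notation nz := (nzvec d.+1).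
Local Notation pm := (proper_mult d.+1).

Definition structure_constants (p : pm) : {ffun 'I_d.+1 * 'I_d.+1 -> 'rV[int]_d.+1} :=
  [ffun ij => p 'e_ij.1 'e_ij.2].

Lemma structure_constants_inj : injective structure_constants.
Proof.
move=> p p' /ffunP pp'.
have : pmul p = pmul p'.
  apply/funext => x; apply/funext => y; rewrite !pmul_sum.
  apply: eq_bigr => i _; apply: eq_bigr => j _.
  by have := pp' (i, j); rewrite !ffunE /= => ->.
case: p p' {pp'} => [m a1 a2 a3 a4] [m' b1 b2 b3 b4] /= mm'.
by subst m'; congr ProperMult; apply: Prop_irrelevance.
Qed.

Definition pcode (p : pm) : nat := choice.pickle (structure_constants p).

Lemma pcode_inj : injective pcode.
Proof. by move=> p q /(pcan_inj choice.pickleK)/structure_constants_inj. Qed.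

Definition vcode (g : nz) : nat := choice.pickle g.

Lemma vcode_inj : injective vcode.
Proof. exact: pcan_inj choice.pickleK. Qed.

(* [x] is a valid base point for stage [n], where [E] collects the earlier
   blocks: no right translate by [s] meets both [E] and the new block, and two
   hits of a translate in the new block occur only for an algebraic reason. *)
Definition admissible (n : nat) (E F : seq nz) (p : pm) (x : nz) : Prop :=
  forall q, (pcode q < n)%N -> forall g0, (vcode g0 < n)%N ->
  forall g, (vcode g < n)%N -> forall f, f \in F ->
  (forall y, y \in E -> forall s, nzmul q g0 s = y -> nzmul q g s <> nzmul p f x) /\
  (forall f0, f0 \in F -> forall s, nzmul q g0 s = nzmul p f0 x ->
     nzmul q g s = nzmul p f x -> nztransfer q p g0 g).

(** Codes below [n] leave finitely many conditions, each violated at only finitely many points of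
    the curve. *)
Lemma ex_admissible n E F p : exists x, admissible n E F p x.
Proof.
suff /cofinitely_ex[t] : cofinitely (fun t => admissible n E F p (nzcurve d 0 t)).
  by exists (nzcurve d 0 t).
apply: (cofinitely_forall (D := [set q | (pcode q < n)%N])) => [|q].
  exact: finite_below pcode_inj.
apply: (cofinitely_forall (D := [set g | (vcode g < n)%N])) => [|g0].
  exact: finite_below vcode_inj.
apply: (cofinitely_forall (D := [set g | (vcode g < n)%N])) => [|g].
  exact: finite_below vcode_inj.
apply: (cofinitely_forall (D := [set` F])) => [|f]; first exact: finite_seq.
apply: cofinitelyI.
  apply: (cofinitely_forall (D := [set` E])) => [|y]; first exact: finite_seq.
  exact: cofinitely_separated.
apply: (cofinitely_forall (D := [set` F])) => [|f0]; first exact: finite_seq.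
exact: cofinitely_transfer.
Qed.

Definition block (o : option (seq nz * pm)) (x : nz) : seq nz :=
  if o is Some (F, p) then [seq nzmul p f x | f <- F] else [::].

Lemma ex_chain (AA : set pm) :
  exists (E : nat -> seq nz) (st : nat -> option (seq nz * pm)) (X : nat -> nz),
  [/\ E 0%N = [::],
      forall n, E n.+1 = E n ++ block (st n) (X n),
      forall n F p, st n = Some (F, p) -> AA p /\ admissible n (E n) F p (X n)
    & forall F p, AA p -> exists n, st n = Some (F, p)].
Proof.
have nuI : injective (fun Fp : seq nz * pm => choice.pickle (Fp.1, pcode Fp.2)).
  by move=> [F p] [F' p'] /(pcan_inj choice.pickleK)[-> /pcode_inj ->].
have [dec decP] := ex_decoder nuI.
(* A number that codes no pair with multiplication in [AA] gives an idle stage, with empty block. *)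
pose st n := if dec n is Some (F, p) then
  if `[< AA p >] then Some (F, p) else None else None.
(* A base point is chosen for all possible stage data at once, so that [E] can be defined by plain
   recursion. *)
have /choice[Xc XcP] (a : nat * seq nz * seq nz * pm) :
    exists x, admissible a.1.1.1 a.1.1.2 a.1.2 a.2 x.
  exact: ex_admissible.
pose pick n e := if st n is Some (F, p) then Xc (n, e, F, p) else nzcurve d 0 0.
pose E := fix E n := if n is n'.+1 then
  E n' ++ block (st n') (pick n' (E n')) else [::].
exists E, st, (fun n => pick n (E n)); split=> //.
- move=> n F p stn; split; last by rewrite /pick stn; apply: (XcP (n, E n, F, p)).
  move: stn; rewrite /st; case: (dec n) => [[F' p']|//].
  by case: asboolP => // AAp [_ <-].
- move=> F p AAp; exists (choice.pickle (F, pcode p)).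
  by rewrite /st (decP (F, p)) asboolT.
Qed.

(** * How translates meet the union of the blocks *)

Section Chain.
Variables (AA : set pm) (E : nat -> seq nz) (st : nat -> option (seq nz * pm)).
Variable X : nat -> nz.
Hypothesis E0 : E 0%N = [::].
Hypothesis ES : forall n, E n.+1 = E n ++ block (st n) (X n).
Hypothesis stP : forall n F p, st n = Some (F, p) ->
  AA p /\ admissible n (E n) F p (X n).

Definition chain_union : set nz := [set y | exists n, y \in E n].

Lemma chain_mono m n : (m <= n)%N -> {subset E m <= E n}.
Proof.
move=> /subnK <-; elim: (n - m)%N => [//|k IH] y /IH.
by rewrite addSn ES mem_cat => ->.
Qed.

Lemma chain_entry N y : y \in chain_union -> y \notin E N ->
  exists n F p f, [/\ (N <= n)%N, st n = Some (F, p), f \in F & y = nzmul p f (X n)].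
Proof.
rewrite inE => -[m]; elim: m => [|m IH]; first by rewrite E0.
move=> ym yN; have [/IH/(_ yN)//|ym'] := boolP (y \in E m).
have Nm : (N <= m)%N.
  by rewrite leqNgt; apply: contra yN => mN; apply: chain_mono ym.
move: ym; rewrite ES mem_cat (negPf ym') /=.
case stm: (st m) => [[F p]|//] /mapP[f fF ->].
by exists m, F, p, f.
Qed.

(** Both hits lie in blocks of stages at least [N], where admissibility covers [q], [g0] and [g].
    Different stages would contradict separation at the later one, with [g0] and [g] exchanged if
    that is the stage of [g0 s]. In a common stage the transfer clause applies. As [p] comes from
    the block of [g0 s], it serves all [g]. *)
Lemma chain_transfer (q : pm) (N : nat) (g0 s : nz) :
    (pcode q < N)%N -> (vcode g0 < N)%N ->
    nzmul q g0 s \in chain_union -> nzmul q g0 s \notin E N ->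
  exists2 p, AA p & forall g, (vcode g < N)%N ->
    nzmul q g s \in chain_union -> nzmul q g s \notin E N -> nztransfer q p g0 g.
Proof.
move=> qN g0N yA yE.
have [n0 [F0 [p0 [f0 [Nn0 st0 f0F y0]]]]] := chain_entry yA yE.
exists p0; first by case: (stP st0).
move=> g gN zA zE; have [n [F [p [f [Nn stn fF z]]]]] := chain_entry zA zE.
have entryE m G r h : st m = Some (G, r) -> h \in G -> nzmul r h (X m) \in E m.+1.
  by move=> stm hG; rewrite ES stm mem_cat; apply/orP; right; apply/mapP; exists h.
case: (ltngtP n0 n) => [n0n|nn0|nn].
- have [_ /(_ q (leq_trans qN Nn) g0 (leq_trans g0N Nn) g (leq_trans gN Nn) f fF)] := stP stn.
  case=> /(_ (nzmul q g0 s)) sep _; case: (sep _ s) => //.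
  by rewrite y0; apply: chain_mono n0n _ _; apply: entryE st0 f0F.
- have [_ /(_ q (leq_trans qN Nn0) g (leq_trans gN Nn0) g0 (leq_trans g0N Nn0) f0 f0F)] := stP st0.
  case=> /(_ (nzmul q g s)) sep _; case: (sep _ s) => //.
  by rewrite z; apply: chain_mono nn0 _ _; apply: entryE stn fF.
- move: stn z; rewrite -nn st0 => -[FF pp] z; rewrite -FF -pp in fF z.
  have [_ /(_ q (leq_trans qN Nn0) g0 (leq_trans g0N Nn0) g (leq_trans gN Nn0) f fF)] := stP st0.
  by case=> _ /(_ f0 f0F s y0 z).
Qed.

(** The first hit [t0] serves as base point: all hits transfer relative to it, so more than [d] of
    them would align [q] with a member of [AA]. *)
Lemma chain_few_hits (q : pm) (N M : nat) (a s : nz) :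
    (forall p, AA p -> ~ aligned q p) -> (pcode q < N)%N ->
    (forall t, (t < M)%N -> (vcode (nzmul q a (nzcurve d 0 t)) < N)%N) ->
  (count (fun t => let y := nzmul q (nzmul q a (nzcurve d 0 t)) s in
    (y \in chain_union) && (y \notin E N)) (iota 0 M) <= d)%N.
Proof.
move=> nal qN aN; rewrite leqNgt; apply/negP.
set P := (X in count X _); rewrite -size_filter => dM.
case L: [seq t <- iota 0 M | P t] => [|t0 L']; first by rewrite L in dM.
have LP t : t \in [seq t <- iota 0 M | P t] -> (t < M)%N /\ P t.
  by rewrite mem_filter mem_iota add0n => /andP[Pt /andP[_ tM]].
have [t0M /andP[t0A t0E]] : (t0 < M)%N /\ P t0 by apply: LP; rewrite L mem_head.
have [p AAp pP] := chain_transfer qN (aN _ t0M) t0A t0E.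
apply: (nal _ AAp); apply: (transfer_curve_aligned (a := a) (t0 := t0) _ dM).
  exact: filter_uniq (iota_uniq _ _).
by move=> t /LP[tM /andP[tA tE]]; apply: pP => //; apply: aN.
Qed.

Lemma nzscale_neq0 j (x : nz) : val x *+ 3 ^ j != 0.
Proof.
apply: contra (valP x) => /eqP/rowP x0; apply/eqP/rowP => i.
by have /eqP := x0 i; rewrite mulmxnE !mxE mulrn_eq0 expn_eq0 /= => /eqP.
Qed.

(** The dilation moves to the right factor. Hence hits on every dilate are bounded by
    [chain_few_hits] with one and the same [N], at the price of changing the translating vector. *)
Lemma nzmul_curve_scale (q : pm) j t (x : nz) :
  nzmul q (nzcurve d j t) x =
  nzmul q (nzcurve d 0 t) (exist _ (val x *+ 3 ^ j) (nzscale_neq0 j x)).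
Proof.
apply: val_inj => /=.
rewrite -[_ *+ _]scaler_nat (linear_mapZ (pmul_linear_r q _)).
rewrite -(linear_mapZ (pmul_linear_l q _)); congr (q _ _).
apply/rowP => i; rewrite !mxE natz -PoszM expn0 muln1.
by rewrite mulnA [(3 ^ j * _)%N]mulnC.
Qed.

Lemma chain_sparse (q : pm) (r : seq nz) (K : nat) :
    (forall p, AA p -> ~ aligned q p) -> (0 < K)%N ->
  exists L : seq nz, [/\ uniq L, (0 < size L)%N & forall a x, a \in r ->
    (K * count (fun f => nzmul q a (nzmul q f x) \in chain_union) L <= size L)%N].
Proof.
move=> nal K_gt0; pose M := (K * d.+1)%N.
have [N NP] := ex_strict_bound (pcode q ::
  [seq vcode (nzmul q a (nzcurve d 0 t)) | a <- r, t <- iota 0 M]).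
have qN : (pcode q < N)%N by apply: NP; rewrite mem_head.
have aN a t : a \in r -> (t < M)%N -> (vcode (nzmul q a (nzcurve d 0 t)) < N)%N.
  move=> ar tM; apply: NP; rewrite in_cons; apply/orP; right.
  by apply: allpairs_f => //; rewrite mem_iota.
(* [N] is fixed before [J], so the number of dilates can exceed the size of [E N]. Hits then number
   at most [J * d] outside [E N] and [J] inside, against [J * K * (d + 1)] points. *)
pose J := (size (E N)).+1.
pose L := [seq nzcurve d j t | j <- iota 0 J, t <- iota 0 M].
have sL : size L = (J * M)%N by rewrite size_allpairs !size_iota.
have uL : uniq L.
  apply: allpairs_uniq; rewrite ?iota_uniq // => -[j t] [j' t'] _ _ /=.
  by move=> /nzcurve_inj[-> ->].
exists L; split=> // [|a x ar]; first by rewrite sL !muln_gt0 K_gt0.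
set A := chain_union.
pose Y f := nzmul q a (nzmul q f x).
have YI : injective Y by move=> f f' /nzmulI/nzmul_Ir.
pose old f := Y f \in E N.
pose new f := (Y f \in A) && (Y f \notin E N).
have cold : (count old L <= size (E N))%N.
  rewrite -size_filter -(size_map Y); apply: uniq_leq_size.
    by rewrite map_inj_uniq // filter_uniq.
  by move=> y /mapP[f]; rewrite mem_filter => /andP[fo _] ->.
have cnew : (count new L <= J * d)%N.
  rewrite count_allpairs -{2}(size_iota 0 J) -sum1_size big_distrl /=.
  apply: leq_sum => j _; rewrite mul1n.
  pose s : nz := exist _ (val x *+ 3 ^ j) (nzscale_neq0 j x).
  apply: leq_trans (chain_few_hits s nal qN (fun t => aN a t ar)).
  by apply: sub_count => t; rewrite /new /Y /= nzmul_curve_scale nzmulA.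
have -> : (size L = K * (J * d) + K * J)%N by rewrite sL /M mulnCA mulnS -mulnDr addnC.
have cA : (count (fun f => Y f \in A) L <= count new L + count old L)%N.
  rewrite -count_predUI; apply: leq_trans (leq_addr _ _).
  by apply: sub_count => f /= fA; rewrite /new /old fA /= orNb.
apply: leq_trans (leq_mul (leqnn K) cA) _; rewrite mulnDr.
by apply: leq_add; rewrite leq_mul2l ?cnew ?orbT // (leq_trans cold) ?orbT.
Qed.

Lemma chain_not_piecewise_syndetic (q : pm) :
  (forall p, AA p -> ~ aligned q p) ->
  ~ piecewise_syndetic (nzmul q) chain_union.
Proof.
move=> nal [r thr].
(* With [K] one more than the size of [r], each element of [r] accounts for at most the fraction
   [1 / K] of [L], so all of them together cannot cover [L]. *)
have [L [uL L0 LP]] := chain_sparse r nal (ltn0Sn (size r)).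
have [x xP] := thr [fset f in L].
have : (size L <= \sum_(a <- r)
    count (fun f => nzmul q a (nzmul q f x) \in chain_union) L)%N.
  apply: leq_trans (count_has _ r L).
  rewrite eq_leq //; apply/esym/eqP; rewrite -all_count; apply/allP => f fL.
  have [|a ar afx] := xP f; first by rewrite in_fset.
  by apply/hasP; exists a => //; rewrite inE.
move=> /(leq_mul (leqnn (size r).+1)); rewrite big_distrr /=.
apply/negP; rewrite -ltnNge.
apply: (@leq_ltn_trans (size r * size L)%N); last by rewrite ltn_mul2r L0 ltnSn.
rewrite -sum1_size big_distrl /= big_seq [X in (_ <= X)%N]big_seq.
by apply: leq_sum => a ar; rewrite mul1n sum1_size; apply: LP.
Qed.

Lemma chain_upper_density0 (R : realType) (q : pm) :
  (forall p, AA p -> ~ aligned q p) ->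
  upper_density (nzmul q) R chain_union = 0.
Proof.
move=> nal; rewrite /upper_density -[RHS]sup1; congr sup.
(* The set of admissible densities is shown to be exactly [{0}]. *)
apply/seteqP; split=> [c /= [c0 cP]|c /= ->]; last first.
  by split=> // F; exists (nzcurve d 0 0); rewrite mul0r ler0n.
apply/eqP; rewrite eq_le c0 andbT leNgt; apply/negP => c_gt0.
(* The sparseness bound concerns products [b (f s)], so the density is tested on the left translate
   of [L] by an arbitrary nonzero [b]. The choice of [K] above [1 / c] yields the contradiction. *)
pose b := nzcurve d 0 0.
pose K := Num.bound c^-1.
have cK : 1 < K%:R * c.
  by rewrite -ltr_pdivrMr // div1r; apply: archi_boundP; rewrite invr_ge0.
have K_gt0 : (0 < K)%N.
  by rewrite lt0n; apply/eqP => K0; move: cK; rewrite K0 mul0r ltr10.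
have [L [uL L0 LP]] := chain_sparse [:: b] nal K_gt0.
pose bL := [seq nzmul q b f | f <- L].
have [s] := cP [fset y in bL].
have -> : #|` [fset y in bL]| = size L.
  by rewrite card_fseq undup_id ?size_map // map_inj_uniq // => f f' /nzmulI.
pose P f := nzmul q b (nzmul q f s) \in chain_union.
set B := [fset y in _ | _].
have BL : (#|` B| <= count P L)%N.
  pose C := [seq nzmul q b (nzmul q f s) | f <- L & P f].
  have : (B `<=` [fset y in C])%fset.
    apply/fsubsetP => y; rewrite !inE /= => /andP[/imfsetP[g /=]].
    rewrite in_fset => /mapP[f fL ->] -> fA; apply/mapP; exists f; last by rewrite nzmulA.
    by rewrite mem_filter fL andbT /P nzmulA.
  move=> /fsubset_leq_card/leq_trans; apply.
  by rewrite card_fseq (leq_trans (size_undup _)) // size_map size_filter.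
move=> /le_trans/(_ (_ : _ <= (count P L)%:R)); rewrite ler_nat => /(_ BL) cL.
have := LP b s (mem_head _ _); rewrite -(ler_nat R) natrM.
apply/negP; rewrite -ltNge.
have L0' : 0 < (size L)%:R :> R by rewrite ltr0n.
apply: (@lt_le_trans _ _ (K%:R * (c * (size L)%:R))).
  by rewrite mulrA ltr_pMl.
by rewrite ler_wpM2l.
Qed.

End Chain.
End Construction.

Theorem theorem5p9 (R : realType) (d : nat) (d_gt0 : (0 < d)%N)
    (AA : set (proper_mult d)) :
  exists A : set (nzvec d),
    (forall p : proper_mult d, AA p -> thick (nzmul p) A) /\
    (forall q : proper_mult d, (forall p : proper_mult d, AA p -> ~ aligned q p) ->
       ~ piecewise_syndetic (nzmul q) A /\
       (left_amenable (nzmul q) R -> upper_density (nzmul q) R A = 0)).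
Proof.
case: d d_gt0 AA => // d _ AA.
have [E [st [X [E0 ES stP AAst]]]] := ex_chain AA.
exists (chain_union E); split=> [p AAp F|q nal].
  have [n stn] := AAst F p AAp.
  exists (X n) => f fF; exists n.+1.
  by rewrite ES stn mem_cat; apply/orP; right; apply/mapP; exists f.
split=> [|_]; first exact: chain_not_piecewise_syndetic nal.
exact: chain_upper_density0 nal.
Qed.
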